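(* Let $\Psi$ be a Kempf-Ness function for $(\mathscr M,G,K)$ and let $x\in\mathscr M$. Then $x$ is stable if and only if $\Lambda(x,\xi)>0$ for every $\xi\in\mathfrak p\setminus\{0\}$.
   Context: $G$ is a non-compact real reductive Lie group: it has finitely many connected components, its Lie algebra is $\mathfrak g=[\mathfrak g,\mathfrak g]\oplus\mathfrak z(\mathfrak g)$ with $[\mathfrak g,\mathfrak g]$ semisimple, and it has a Cartan involution whose fixed point set $K$ is a maximal compact subgroup; $\mathfrak g=\mathfrak k\oplus\mathfrak p$ is the corresponding decomposition into $(+1)$- and $(-1)$-eigenspaces, and $K\times\mathfrak p\to G$, $(k,v)\mapsto k\exp(v)$, is a diffeomorphism. $\mathscr M$ is a Hausdorff topological space with a continuous $G$-action; $G_x$ is the stabilizer of $x$ and $\mathfrak g_x$ its Lie algebra. A Kempf-Ness function for $(\mathscr M,G,K)$ is a function $\Psi:\mathscr M\times G\to\mathbb R$ such that: (P1) for every $x\in\mathscr M$, $\Psi(x,\cdot)$ is smooth on $G$; (P2) $\Psi(x,kg)=\Psi(x,g)$ for all $k\in K$, $g\in G$; (P3) for all $x\in\mathscr M$, $v\in\mathfrak p$, $t\in\mathbb R$: $\frac{d^2}{dt^2}\Psi(x,\exp(tv))\ge 0$, and $\frac{d^2}{dt^2}\big|_{t=0}\Psi(x,\exp(tv))=0$ if and only if $\exp(\mathbb R v)\subset G_x$; (P4) $\Psi(x,g)+\Psi(gx,h)=\Psi(x,hg)$ for all $x\in\mathscr M$, $g,h\in G$; (P5) the gradient map $\mathfrak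 F:\mathscr M\to\mathfrak p^*$, $\langle\mathfrak F(x),v\rangle=\frac{d}{dt}\big|_{t=0}\Psi(x,\exp(tv))$, is continuous. A point $x$ is polystable if $Gx\cap\mathfrak F^{-1}(0)\neq\emptyset$; it is stable if it is polystable and $\mathfrak g_x$ is conjugate (under $\mathrm{Ad}(G)$) to a subalgebra of $\mathfrak k$. The function $\Lambda:\mathscr M\times\mathfrak p\to[-\infty,+\infty]$ is $\Lambda(x,\xi)=\lim_{t\to+\infty}\frac{d}{dt}\Psi(x,\exp(t\xi))$. *)

(* Defs.v *)
From HB Require Import structures.
From mathcomp Require Import all_boot all_order all_algebra.
From mathcomp Require Import all_classical all_reals all_analysis.
Set Implicit Arguments.
Unset Strict Implicit.
Unset Printing Implicit Defensive.
Import Order.TTheory GRing.Theory Num.Theory numFieldNormedType.Exports.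
Local Open Scope classical_set_scope.
Local Open Scope ring_scope.

(* ** Smooth manifolds with a finite-dimensional model space *)

(* C^k on an open set U: for finite-dimensional E, all iterated directional
   derivatives up to order k exist and are continuous on U. *)
Fixpoint Ck (R : realType) (E F : normedModType R) (k : nat) (U : set E)
    (f : E -> F) : Prop :=
  if k is k'.+1 then
    (forall x, U x -> differentiable f x) /\
    (forall v, Ck k' U (fun x => 'D_v f x))
  else forall x, U x -> {for x, continuous f}.

Definition smooth_on (R : realType) (E F : normedModType R) (U : set E)
  (f : E -> F) := forall k, Ck k U f.

(* Raw data of a chart; the values of [fwd] off [dom] and of [bwd] off
   [fwd @` dom] are irrelevant. *)
Record chart (R : realType) (E : normedModType R) (M : topologicalType) :=
  Chart { dom : set M; fwd : M -> E; bwd : E -> M }.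

Definition img (R : realType) (E : normedModType R) (M : topologicalType)
  (c : chart E M) : set E := fwd c @` dom c.

Record is_chart (R : realType) (E : normedModType R) (M : topologicalType)
    (c : chart E M) : Prop := {
  chart_open : open (dom c);
  chart_img_open : open (img c);
  chart_fwdK : forall x, dom c x -> bwd c (fwd c x) = x;
  chart_fwd_cts : forall x, dom c x -> {for x, continuous (fwd c)};
  chart_bwd_cts : forall y, img c y -> {for y, continuous (bwd c)} }.

Record smooth_atlas (R : realType) (E : normedModType R) (M : topologicalType)
    (A : set (chart E M)) : Prop := {
  atlas_chart : forall c, A c -> is_chart c;
  atlas_cover : forall x, exists2 c, A c & dom c x;
  atlas_smooth : forall c d, A c -> A d ->
    smooth_on (fwd c @` (dom c `&` dom d)) (fwd d \o bwd c) }.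

Definition smooth_map (R : realType) (E F : normedModType R)
    (M N : topologicalType) (A : set (chart E M)) (B : set (chart F N))
    (f : M -> N) : Prop :=
  continuous f /\
  forall c d, A c -> B d ->
    smooth_on (fwd c @` (dom c `&` f @^-1` dom d)) (fwd d \o f \o bwd c).

Definition vect_atlas (R : realType) (E : normedModType R) : set (chart E E) :=
  [set Chart setT id id].
Arguments vect_atlas {R} E.

Definition prod_chart (R : realType) (E F : normedModType R)
    (M N : topologicalType) (c : chart E M) (d : chart F N) :
    chart (E * F)%type (M * N)%type :=
  Chart (dom c `*` dom d) (fun z => (fwd c z.1, fwd d z.2))
    (fun w => (bwd c w.1, bwd d w.2)).

Definition prod_atlas (R : realType) (E F : normedModType R)
    (M N : topologicalType) (A : set (chart E M)) (B : set (chart F N)) :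
    set (chart (E * F)%type (M * N)%type) :=
  [set e | exists c d, [/\ A c, B d & e = prod_chart c d]].

(* ** Lie groups *)

(* [lie_chart1] only serves to coordinatize the tangent space at 1: below,
   the Lie algebra of G is 'rV[R]_n, read through this chart. *)
HB.mixin Record isLieGroup (R : realType) (n : nat) G
    of Group G & Topological G := {
  lie_atlas : set (chart 'rV[R]_n G);
  lie_atlas_smooth : smooth_atlas lie_atlas;
  lie_hausdorff : hausdorff_space G;
  lie_second_countable : @second_countable G;
  lie_mul_smooth : smooth_map (prod_atlas lie_atlas lie_atlas) lie_atlas
    (fun z : G * G => (z.1 * z.2)%g);
  lie_inv_smooth : smooth_map lie_atlas lie_atlas (fun g : G => g^-1%g);
  lie_chart1 : chart 'rV[R]_n G;
  lie_chart1_in : lie_atlas lie_chart1;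
  lie_chart1_dom : dom lie_chart1 1%g }.

#[short(type="lieGroupType")]
HB.structure Definition LieGroup (R : realType) (n : nat) :=
  {G of Group G & Topological G & isLieGroup R n G}.

(* Differential at 1 of a smooth f : G -> G with f 1 = 1. *)
Definition dmap1 (R : realType) (n : nat) (G : lieGroupType R n) (f : G -> G)
    (v : 'rV[R]_n) : 'rV[R]_n :=
  let c : chart 'rV[R]_n G := lie_chart1 in
  'D_v (fwd c \o f \o bwd c) (fwd c 1%g).

Definition one_parameter_subgroup (R : realType) (n : nat)
    (G : lieGroupType R n) (gamma : R -> G) (v : 'rV[R]_n) : Prop :=
  let c : chart 'rV[R]_n G := lie_chart1 in
  [/\ smooth_map (vect_atlas R) (lie_atlas : set (chart 'rV[R]_n G)) gamma,
      forall s t : R, gamma (s + t) = (gamma s * gamma t)%g &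
      derive1 (fwd c \o gamma) 0 = v].

(* exp is characterized by: for every v, t |-> exp (t v) is the unique
   one-parameter subgroup with initial velocity v.  Every Lie group has exactly
   one such map. *)
Definition is_exp (R : realType) (n : nat) (G : lieGroupType R n)
    (exp : 'rV[R]_n -> G) : Prop :=
  forall (v : 'rV[R]_n) (gamma : R -> G),
    one_parameter_subgroup gamma v <-> gamma = (fun t : R => exp (t *: v)).

Definition Ad (R : realType) (n : nat) (G : lieGroupType R n) (g : G) :
    'rV[R]_n -> 'rV[R]_n :=
  dmap1 (fun h : G => (g * h * g^-1)%g).

(* The Lie bracket, defined as ad = d(Ad):
   [u, v] = d/ds Ad (exp (s u)) v at s = 0. *)
Definition bracket (R : realType) (n : nat) (G : lieGroupType R n)
    (exp : 'rV[R]_n -> G) (u v : 'rV[R]_n) : 'rV[R]_n :=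
  derive1 (fun s : R => Ad (exp (s *: u)) v) 0.

(* ** Reductive Lie algebras *)

Definition subspace (R : realType) (n : nat) (S : set 'rV[R]_n) : Prop :=
  S 0 /\ forall (a : R) u v, S u -> S v -> S (a *: u + v).

Definition linear_span (R : realType) (n : nat) (A : set 'rV[R]_n) :
    set 'rV[R]_n :=
  [set v | forall S, subspace S -> A `<=` S -> S v].

Section LieAlgebra.
Context (R : realType) (n : nat) (br : 'rV[R]_n -> 'rV[R]_n -> 'rV[R]_n).

Definition bracket_span (A B : set 'rV[R]_n) : set 'rV[R]_n :=
  linear_span [set w | exists u v, [/\ A u, B v & w = br u v]].

Definition lie_derived : set 'rV[R]_n := bracket_span setT setT.

Definition lie_center : set 'rV[R]_n := [set v | forall u, br u v = 0].

Definition lie_ideal (L I : set 'rV[R]_n) : Prop :=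
  [/\ subspace I, I `<=` L & bracket_span L I `<=` I].

Definition lie_solvable (I : set 'rV[R]_n) : Prop :=
  exists k, iter k (fun S => bracket_span S S) I `<=` [set 0].

Definition lie_semisimple (L : set 'rV[R]_n) : Prop :=
  forall I, lie_ideal L I -> lie_solvable I -> I `<=` [set 0].

(* The whole algebra is the direct sum of its derived algebra, which is
   semisimple, and of its center. *)
Definition lie_reductive : Prop :=
  [/\ forall v, exists a b, [/\ lie_derived a, lie_center b & v = a + b],
      lie_derived `&` lie_center `<=` [set 0] &
      lie_semisimple lie_derived].

(* Killing form trace (ad u ad v); on the ideal [lie_derived] it coincides
   with the Killing form of that ideal. *)
Definition killing (u v : 'rV[R]_n) : R :=
  \tr (lin1_mx (br u) *m lin1_mx (br v)).

End LieAlgebra.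

(* ** Real reductive Lie groups *)

Record is_subgroup (R : realType) (n : nat) (G : lieGroupType R n)
    (H : set G) : Prop := {
  subgroup1 : H 1%g;
  subgroupM : forall g h, H g -> H h -> H (g * h)%g;
  subgroupV : forall g, H g -> H g^-1%g }.

Definition maximal_compact_subgroup (R : realType) (n : nat)
    (G : lieGroupType R n) (K : set G) : Prop :=
  [/\ is_subgroup K, compact K &
      forall L : set G, is_subgroup L -> compact L -> K `<=` L -> L = K].

Definition fixed_group (R : realType) (n : nat) (G : lieGroupType R n)
    (Theta : G -> G) : set G := [set g | Theta g = g].

Definition cartan_k (R : realType) (n : nat) (G : lieGroupType R n)
    (Theta : G -> G) : set 'rV[R]_n := [set v | dmap1 Theta v = v].

Definition cartan_p (R : realType) (n : nat) (G : lieGroupType R n)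
    (Theta : G -> G) : set 'rV[R]_n := [set v | dmap1 Theta v = - v].

(* A global Cartan involution: a smooth involutive automorphism whose
   differential theta restricts to a Cartan involution of the semisimple part,
   i.e. (u, v) |-> - B (u, theta v) is positive definite there. *)
Record cartan_involution (R : realType) (n : nat) (G : lieGroupType R n)
    (exp : 'rV[R]_n -> G) (Theta : G -> G) : Prop := {
  cartan_smooth : smooth_map (lie_atlas : set (chart 'rV[R]_n G))
    (lie_atlas : set (chart 'rV[R]_n G)) Theta;
  cartan_morph : forall g h : G, Theta (g * h)%g = (Theta g * Theta h)%g;
  cartan_involutive : forall g, Theta (Theta g) = g;
  cartan_definite : forall v : 'rV[R]_n, lie_derived (bracket exp) v ->
    v != 0 -> killing (bracket exp) v (dmap1 Theta v) < 0 }.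

(* (k, v) |-> k exp v is a diffeomorphism from K x p onto G.  K x p is an
   embedded submanifold of G x Lie(G), so smoothness of the map and of its
   inverse (kappa, pi) can be expressed in the ambient manifolds. *)
Definition polar_diffeomorphism (R : realType) (n : nat)
    (G : lieGroupType R n) (exp : 'rV[R]_n -> G) (Theta : G -> G) : Prop :=
  let A : set (chart 'rV[R]_n G) := lie_atlas in
  let V := vect_atlas 'rV[R]_n in
  smooth_map (prod_atlas A V) A (fun z : G * 'rV[R]_n => (z.1 * exp z.2)%g) /\
  exists (kappa : G -> G) (pi : G -> 'rV[R]_n),
    [/\ smooth_map A A kappa, smooth_map A V pi,
        forall g, [/\ fixed_group Theta (kappa g), cartan_p Theta (pi g) &
                      (kappa g * exp (pi g))%g = g] &
        forall k v, fixed_group Theta k -> cartan_p Theta v ->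
          kappa (k * exp v)%g = k /\ pi (k * exp v)%g = v].

Record real_reductive (R : realType) (n : nat) (G : lieGroupType R n)
    (exp : 'rV[R]_n -> G) (Theta : G -> G) : Prop := {
  reductive_components :
    finite_set (range (connected_component [set: G]));
  reductive_algebra : lie_reductive (bracket exp);
  reductive_cartan : cartan_involution exp Theta;
  reductive_maximal_compact : maximal_compact_subgroup (fixed_group Theta);
  reductive_polar : polar_diffeomorphism exp Theta }.

(* ** Actions and Kempf-Ness functions *)

Record continuous_action (R : realType) (n : nat) (G : lieGroupType R n)
    (M : topologicalType) (act : G -> M -> M) : Prop := {
  act_continuous : continuous (fun z : G * M => act z.1 z.2);
  act_id : forall x, act 1%g x = x;
  act_comp : forall g h x, act (g * h)%g x = act g (act h x) }.

Definition stabilizer (R : realType) (n : nat) (G : lieGroupType R n)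
    (M : topologicalType) (act : G -> M -> M) (x : M) : set G :=
  [set g | act g x = x].

(* Lie algebra of the closed subgroup H *)
Definition lie_of (R : realType) (n : nat) (G : lieGroupType R n)
    (exp : 'rV[R]_n -> G) (H : set G) : set 'rV[R]_n :=
  [set v | forall t : R, H (exp (t *: v))].

Section KempfNess.
Context (R : realType) (n : nat) (G : lieGroupType R n)
  (exp : 'rV[R]_n -> G) (Theta : G -> G) (M : topologicalType)
  (act : G -> M -> M) (Psi : M -> G -> R).

Definition ray (x : M) (v : 'rV[R]_n) : R -> R :=
  fun t => Psi x (exp (t *: v)).

(* The linear form F x on p, as a real function on p; it is linear because
   [Psi x] is smooth.  Pointwise convergence is the usual topology of the
   finite-dimensional space p^*. *)
Definition gradient_map (x : M) : {ptws (set_type (cartan_p Theta)) -> R} :=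
  fun v => derive1 (ray x (\val v)) 0.

Record kempf_ness : Prop := {
  kn_smooth : forall x,
    smooth_map (lie_atlas : set (chart 'rV[R]_n G)) (vect_atlas R) (Psi x);
  kn_invariant : forall x k g,
    fixed_group Theta k -> Psi x (k * g)%g = Psi x g;
  kn_convex : forall x v, cartan_p Theta v -> forall t, 0 <= derive1n 2 (ray x v) t;
  kn_flat : forall x v, cartan_p Theta v ->
    (derive1n 2 (ray x v) 0 = 0 <-> forall t : R, stabilizer act x (exp (t *: v)));
  kn_cocycle : forall x g h,
    Psi x g + Psi (act g x) h = Psi x (h * g)%g;
  kn_gradient_continuous : continuous gradient_map }.

Definition polystable (x : M) : Prop :=
  range (act^~ x) `&` [set y | gradient_map y = (fun=> 0)] !=set0.

(* [lie_of (stabilizer x)] is a Lie subalgebra, hence so is its image under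
   [Ad h]; the latter is a subalgebra of k as soon as it is contained in k. *)
Definition stable (x : M) : Prop :=
  polystable x /\
  exists h : G, Ad h @` lie_of exp (stabilizer act x) `<=` cartan_k Theta.

Definition Lambda (x : M) (xi : 'rV[R]_n) : \bar R :=
  lim ((fun t : R => (derive1 (ray x xi) t)%:E) @ +oo%R).

End KempfNess.

(* Main.v *)
Require Import Defs.
From HB Require Import structures.
From mathcomp Require Import all_boot all_order all_algebra.
From mathcomp Require Import all_classical all_reals all_analysis.
From mathcomp Require Import lra.
Set Implicit Arguments.
Unset Strict Implicit.
Unset Printing Implicit Defensive.
Import Order.TTheory GRing.Theory Num.Theory numFieldNormedType.Exports.
Local Open Scope classical_set_scope.
Local Open Scope ring_scope.

(* On p, the function v |-> Psi x (exp v) is convex along rays from 0, and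
   Lambda x v > 0 says exactly that it tends to +oo along the ray of v.
   If Lambda x is positive, compactness of the unit sphere of p makes this
   function proper, so by G = K exp p it attains its minimum at some exp v0;
   then y = exp v0 . x is critical.  On the stabilizer of y the function Psi y is a
   nonnegative homomorphism to R, hence 0, so by (P3) any k exp v fixing y gives
   a line exp (R v) fixing y; properness excludes it unless v = 0, and G_y lies
   in K.
   Conversely, if y = g x is critical and g_x is conjugate into k, no line
   exp (R v) fixes y, for it would be conjugate into the compact group K.  So
   Psi y (exp v) is strictly convex at 0 and grows at least linearly in |v|.
   Writing exp (t xi) g^-1 = k(t) exp w(t), the vectors w(t) are unbounded, so
   Psi x (exp (t xi)) = Psi y (exp w(t)) - Psi y g^-1 is unbounded above and its
   slope is positive somewhere. *)

(** * Calculus of [Ck] functions *)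

(** The first-order expansion of [f] at [x] only sees values near [x], so it is also one of [g];
    uniqueness of the differential then gives ['d g x = 'd f x]. *)
Lemma near_eq_differentiable (R : realType) (E F : normedModType R)
    (f g : E -> F) (x : E) :
  {near x, f =1 g} -> differentiable f x -> differentiable g x.
Proof.
move=> fg /diff_locallyP[dfc dfx].
have gx : g x = f x by rewrite (nbhs_singleton fg).
have dgx : g \o shift x = cst (g x) + 'd f x +o_ 0 id.
  apply/eqaddoP => e e0.
  move/eqaddoP: dfx => /(_ e e0) dfx.
  have fg0 : \forall h \near 0, f (h + x) = g (h + x).
    have : h + x @[h --> (0 : E)] --> x.
      by rewrite -[X in _ --> X]add0r; apply: cvgD; [exact: cvg_id|exact: cvg_cst].
    by move/(_ _ fg).
  near=> h.
  have fgh : f (h + x) = g (h + x) by near: h.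
  have -> : (g \o shift x - (cst (g x) + 'd f x)) h =
            (f \o shift x - (cst (f x) + 'd f x)) h.
    by rewrite !fctE /= gx fgh.
  by near: h.
have dE := diff_unique dfc dgx.
by apply/diff_locallyP; rewrite dE.
Unshelve. all: by end_near. Qed.

Lemma scaler_is_bilinear (R : realType) (F : normedModType R) :
  bilinear_for
    (GRing.Scale.Law.clone _ _ *:%R _) (GRing.Scale.Law.clone _ _ *:%R _)
    (fun (a : R) (v : F) => a *: v).
Proof.
split=> [u'|u] a x y /=.
- by rewrite scalerDl scalerA.
- by rewrite scalerDr !scalerA mulrC.
Qed.

Section ScaleDifferentiable.
Context (R : realType) (F : normedModType R).

(* A named scaling map, to carry the [bilinear] instance. *)
Definition scale_fun (a : R) (v : F) : F := a *: v.

HB.instance Definition _ := bilinear_isBilinear.Build R R F F _ _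
  scale_fun (@scaler_is_bilinear R F).

Lemma differentiable_scale_fun (E : normedModType R) (a : E -> R) (f : E -> F)
    (x v : E) : differentiable a x -> differentiable f x ->
  differentiable (fun y => a y *: f y) x /\
  'D_v (fun y => a y *: f y) x = a x *: 'D_v f x + 'D_v a x *: f x.
Proof.
move=> da df.
have cs : continuous (fun q : R * F => scale_fun q.1 q.2).
  by move=> q; exact: scale_continuous.
have ds := @differentiable_bilin _ _ _ _ scale_fun (a x, f x) cs.
have dp := differentiable_pair da df.
have dc := @differentiable_comp _ _ _ _ _ _ x dp ds.
split=> //.
rewrite !deriveE // (diff_comp dp ds) /= (diff_bilin _ cs).
by rewrite diff_pair.
Qed.

End ScaleDifferentiable.

Section Ck.
Context (R : realType).
Implicit Types E F : normedModType R.

Lemma Ck_sub E F k (U V : set E) (f : E -> F) :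
  V `<=` U -> Ck k U f -> Ck k V f.
Proof.
elim: k f => [|k IH] f VU /=; first by move=> H x /VU; exact: H.
by move=> [df cf]; split=> [x /VU|v]; [exact: df|apply: IH].
Qed.

Lemma CkS_Ck E F k (U : set E) (f : E -> F) : Ck k.+1 U f -> Ck k U f.
Proof.
elim: k f => [|k IH] f.
  by move=> [df _] x Ux; exact: differentiable_continuous (df x Ux).
by move=> [df cf]; split=> // v; apply: IH (cf v).
Qed.

(** [Ck] imposes conditions at the points of the set only, with limits taken in all of [E], so the
    covering sets [V] may be arbitrary. *)
Lemma Ck_local E F k (U : set E) (f : E -> F) :
  (forall x, U x -> exists2 V, V x & Ck k V f) -> Ck k U f.
Proof.
elim: k f => [|k IH] f H /=.
  by move=> x Ux; have [V Vx] := H x Ux; apply.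
split=> [x Ux|v]; first by have [V Vx [df _]] := H x Ux; exact: df.
by apply: IH => x Ux; have [V Vx [_ cf]] := H x Ux; exists V => //; exact: cf.
Qed.

(** Openness turns equality on [U] into equality near each point of [U], which derivatives
    respect. *)
Lemma Ck_congr E F k (U : set E) (f g : E -> F) : open U ->
  (forall x, U x -> f x = g x) -> Ck k U f -> Ck k U g.
Proof.
move=> oU; elim: k f g => [|k IH] f g fg /=.
  move=> cf x Ux; have fx : f @ x --> f x := cf x Ux.
  suff : g @ x --> g x by [].
  rewrite -(fg x Ux); apply: cvg_trans fx.
  by apply: near_eq_cvg; near do rewrite fg //; exact: open_nbhs_nbhs.
have nfg x : U x -> {near x, f =1 g}.
  by move=> Ux; near do rewrite fg //; exact: open_nbhs_nbhs.
move=> [df cf]; split=> [x Ux|v].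
  exact: near_eq_differentiable (nfg x Ux) (df x Ux).
by apply: IH (cf v) => x Ux; exact: near_eq_derive (nfg x Ux).
Unshelve. all: by end_near. Qed.

Lemma Ck_cst E F k (U : set E) (c : F) : Ck k U (fun=> c).
Proof.
elim: k c => [|k IH] c /=; first by move=> x _; exact: cst_continuous.
split=> [x _|v]; first exact: differentiable_cst.
have -> : (fun x => 'D_v (fun=> c : F) x) = (fun=> 0) :> (E -> F); last exact: IH.
by apply/funext => x; exact: derive_cst.
Qed.

(** The derivative of the composite along [v] is the derivative of [f] along the constant direction
    [L v], again precomposed with the affine map, so the induction closes. *)
Lemma Ck_affine E F k (D : normedModType R) (U : set E) (f : E -> F)
    (L : {linear D -> E}) (b : E) : continuous L -> open U ->
  Ck k U f -> Ck k [set y | U (b + L y)] (fun y => f (b + L y)).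
Proof.
move=> cL oU.
have dA y : differentiable (fun y => b + L y) y.
  by apply: differentiableD => //; exact: linear_differentiable.
have cA : continuous (fun y => b + L y).
  by move=> y; exact: differentiable_continuous.
have dAE y v : 'd (fun y => b + L y) y v = L v.
  rewrite (@diffD _ _ _ (cst b) L) //; last exact: linear_differentiable.
  by rewrite diff_cst (diff_lin _ cL) /= add0r.
elim: k f => [|k IH] f /=.
  move=> cf y Uy; apply: (@continuous_comp _ _ _ (fun y => b + L y) f).
    exact: cA.
  exact: cf.
move=> [df cf]; split=> [y Uy|v].
  by apply: (@differentiable_comp _ _ _ _ (fun y => b + L y) f) => //; exact: df.
apply: Ck_congr (IH _ (cf (L v))).
  exact: (@open_comp _ _ (fun y => b + L y)).
move=> y Uy; have dfy := df _ Uy.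
rewrite !deriveE //.
  by rewrite (@diff_comp _ _ _ _ (fun y => b + L y) f) //= dAE.
exact: (@differentiable_comp _ _ _ _ (fun y => b + L y) f).
Qed.

Lemma Ck_linear E F k (D : normedModType R) (U : set E) (f : E -> F)
    (L : {linear F -> D}) : continuous L -> open U ->
  Ck k U f -> Ck k U (L \o f).
Proof.
move=> cL oU.
have dL y : differentiable L y by exact: linear_differentiable.
have dLE y w : 'd L y w = L w by rewrite (diff_lin _ cL).
elim: k f => [|k IH] f /=.
  by move=> cf y Uy; apply: continuous_comp; [exact: cf|exact: cL].
move=> [df cf]; split=> [y Uy|v].
  by apply: differentiable_comp => //; exact: df.
apply: Ck_congr (IH _ (cf v)) => // y Uy; have dfy := df _ Uy.
rewrite /= !deriveE //; last exact: differentiable_comp.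
by rewrite (diff_comp dfy (dL _)) /comp dLE.
Qed.

Lemma CkD E F k (U : set E) (f g : E -> F) : open U ->
  Ck k U f -> Ck k U g -> Ck k U (f \+ g).
Proof.
move=> oU; elim: k f g => [|k IH] f g /=.
  by move=> cf cg x Ux; apply: continuousD; [exact: cf|exact: cg].
move=> [df cf] [dg cg]; split=> [x Ux|v].
  by apply: differentiableD; [exact: df|exact: dg].
apply: Ck_congr (IH _ _ (cf v) (cg v)) => // x Ux.
by rewrite /= deriveD //; apply: diff_derivable; [exact: df|exact: dg].
Qed.

Lemma Ck_sum E F k m (U : set E) (f : 'I_m -> E -> F) : open U ->
  (forall i, Ck k U (f i)) -> Ck k U (fun x => \sum_i f i x).
Proof.
move=> oU; elim: m f => [|m IH] f cf.
  apply: Ck_congr (@Ck_cst _ _ k U (0 : F)) => // x _.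
  by rewrite big_ord0.
apply: Ck_congr
  (CkD oU (IH (fun i => f (widen_ord (leqnSn m) i)) _) (cf ord_max)) => // x _.
by rewrite /= big_ord_recr.
Qed.

(** Each term of the product rule keeps one factor undifferentiated; [CkS_Ck] lowers the order of
    that factor to the one required by the induction hypothesis. *)
Lemma Ck_scale E F k (U : set E) (a : E -> R) (f : E -> F) : open U ->
  Ck k U a -> Ck k U f -> Ck k U (fun x => a x *: f x).
Proof.
move=> oU; elim: k a f => [|k IH] a f.
  move=> ca cf x Ux; apply: cvgZ; [exact: ca|exact: cf].
move=> caS cfS; have ca' := CkS_Ck caS; have cf' := CkS_Ck cfS.
move: caS cfS => [da ca] [df cf]; split=> [x Ux|v].
  by have [] := differentiable_scale_fun 0 (da x Ux) (df x Ux).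
apply: Ck_congr (CkD oU (IH _ _ ca' (cf v)) (IH _ _ (ca v) cf')) => // x Ux.
by have [_ ->] := differentiable_scale_fun v (da x Ux) (df x Ux).
Qed.

Lemma coord_is_linear n (i : 'I_n) : linear (fun v : 'rV[R]_n => v ord0 i).
Proof. by move=> a u v; rewrite !mxE. Qed.

(** In coordinates, ['D_v (g \o f)] is the sum over [i] of the [i]-th coordinate of ['D_v f] times
    the derivative of [g] along a fixed basis vector, evaluated at [f]. The directions being
    constant, the induction hypothesis applies to [g]; this is why the middle space is
    ['rV[R]_n]. *)
Lemma Ck_comp E F n k (U : set E) (V : set 'rV[R]_n) (f : E -> 'rV[R]_n)
    (g : 'rV[R]_n -> F) : open U -> (forall x, U x -> V (f x)) ->
  Ck k U f -> Ck k V g -> Ck k U (g \o f).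
Proof.
move=> oU UV; elim: k g => [|k IH] g.
  move=> cf cg x Ux; apply: continuous_comp; first exact: cf.
  by apply: cg; exact: UV.
move=> cfS; have cf' := CkS_Ck cfS; move: cfS => [df cf] [dg cg].
split=> [x Ux|v].
  by apply: differentiable_comp; [exact: df|apply: dg; exact: UV].
have Lc i : Ck k U (fun x => ('D_v f x) ord0 i).
  pose L : {linear 'rV[R]_n -> R} :=
    HB.pack (fun v : 'rV[R]_n => v ord0 i)
    (GRing.isLinear.Build _ _ _ _ _ (@coord_is_linear n i)).
  have cL : continuous L by move=> u; exact: (@coord_continuous R 1 n ord0 i u).
  exact: Ck_linear cL oU (cf v).
apply: Ck_congr (@Ck_sum _ _ k n U
  (fun i x => ('D_v f x) ord0 i *: 'D_(delta_mx ord0 i) g (f x)) oU _) => //.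
  move=> x Ux; have dfx := df x Ux; have dgx := dg _ (UV x Ux).
  rewrite [RHS]deriveE; last exact: differentiable_comp.
  rewrite diff_comp //= -(deriveE v dfx).
  rewrite [in RHS](row_sum_delta ('D_v f x)) linear_sum.
  by apply: eq_bigr => i _; rewrite linearZ /= (deriveE _ dgx).
by move=> i; exact: (Ck_scale oU (Lc i) (IH _ cf' (cg _))).
Qed.

End Ck.

Lemma Ck_id (R : realType) (E : normedModType R) k (U : set E) : Ck k U (@id E).
Proof.
case: k => [|k] /=; first by move=> x _; exact: cvg_id.
split=> [x _|v]; first exact: (@ex_diff _ _ _ _ _ _ id).
have -> : (fun x => 'D_v id x) = (fun=> v) :> (E -> E); last exact: Ck_cst.
by apply/funext => x; exact: derive_id.
Qed.

(** The inclusion of the slice is the affine map sending [y] to [(a, 0) + (0, y)]. *)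
Lemma Ck_section2 (R : realType) (E F D : normedModType R) k (U : set (E * F)%type)
    (f : (E * F)%type -> D) (a : E) : open U ->
  Ck k U f -> Ck k [set y | U (a, y)] (fun y => f (a, y)).
Proof.
move=> oU cf.
have Lin : linear (fun y : F => (0 : E, y)).
  by move=> c u v; congr pair; rewrite /= scaler0 addr0.
pose L : {linear F -> (E * F)%type} :=
  HB.pack (fun y : F => (0 : E, y)) (GRing.isLinear.Build _ _ _ _ _ Lin).
have cL : continuous (fun y : F => (0 : E, y)).
  by move=> y; apply: cvg_pair; [exact: cvg_cst|exact: cvg_id].
have LE y : (a, 0) + L y = (a, y) by congr pair; rewrite /= ?addr0 ?add0r.
have <- : (fun y => f ((a, 0) + L y)) = (fun y => f (a, y)).
  by apply/funext => y; rewrite LE.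
have <- : [set y | U ((a, 0) + L y)] = [set y | U (a, y)].
  by apply/funext => y; rewrite /mkset LE.
exact: Ck_affine.
Qed.

Lemma Ck_section1 (R : realType) (E F D : normedModType R) k (U : set (E * F)%type)
    (f : (E * F)%type -> D) (b : F) : open U ->
  Ck k U f -> Ck k [set x | U (x, b)] (fun x => f (x, b)).
Proof.
move=> oU cf.
have Lin : linear (fun x : E => (x, 0 : F)).
  by move=> c u v; congr pair; rewrite /= scaler0 addr0.
pose L : {linear E -> (E * F)%type} :=
  HB.pack (fun x : E => (x, 0 : F)) (GRing.isLinear.Build _ _ _ _ _ Lin).
have cL : continuous (fun x : E => (x, 0 : F)).
  by move=> x; apply: cvg_pair; [exact: cvg_id|exact: cvg_cst].
have LE x : (0, b) + L x = (x, b) by congr pair; rewrite /= ?addr0 ?add0r.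
have <- : (fun x => f ((0, b) + L x)) = (fun x => f (x, b)).
  by apply/funext => x; rewrite LE.
have <- : [set x | U ((0, b) + L x)] = [set x | U (x, b)].
  by apply/funext => x; rewrite /mkset LE.
exact: Ck_affine.
Qed.

(** * Smooth maps between manifolds *)

Section Manifolds.
Context (R : realType).
Implicit Types (E F : normedModType R) (M N P : topologicalType).

Lemma chart_image_open E M (c : chart E M) (O : set M) : is_chart c ->
  open O -> open (fwd c @` (dom c `&` O)).
Proof.
move=> hc oO; rewrite openE => _ [p [cp Op] <-].
have ip : img c (fwd c p) by exists p.
have nb : nbhs (fwd c p) (bwd c @^-1` O).
  apply: (chart_bwd_cts hc ip); rewrite /= (chart_fwdK hc cp).
  exact: open_nbhs_nbhs.
have ni : nbhs (fwd c p) (img c).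
  by apply: open_nbhs_nbhs; split=> //; exact: chart_img_open.
apply: filterS (filterI nb ni) => y [Oy [q cq qy]].
by exists q => //; split=> //; move: Oy; rewrite /= -qy (chart_fwdK hc cq).
Qed.

Lemma vect_smooth_atlas E : smooth_atlas (vect_atlas E).
Proof.
split.
- move=> _ ->; split=> //=; first exact: openT.
  + by rewrite /img image_id; exact: openT.
  + by move=> x _; exact: cvg_id.
  + by move=> x _; exact: cvg_id.
- by move=> x; exists (Chart setT id id).
- by move=> _ _ -> -> k; exact: Ck_id.
Qed.

Lemma prod_is_chart E F M N (c : chart E M) (d : chart F N) :
  is_chart c -> is_chart d -> is_chart (prod_chart c d).
Proof.
move=> hc hd.
have iE : img (prod_chart c d) = img c `*` img d.
  apply/seteqP; split=> [_ [[p q] /= [cp dq] <-]|[x y] [/= [p cp <-] [q dq <-]]].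
    by split=> /=; [exists p|exists q].
  by exists (p, q).
split=> //.
- rewrite openE => -[p q] /= [cp dq].
  by exists (dom c, dom d) => //; split=> /=; apply: open_nbhs_nbhs; split=> //;
    exact: chart_open.
- rewrite iE openE => -[p q] /= [cp dq].
  by exists (img c, img d) => //; split=> /=; apply: open_nbhs_nbhs; split=> //;
    exact: chart_img_open.
- by move=> [p q] [/= cp dq]; rewrite (chart_fwdK hc cp) (chart_fwdK hd dq).
- move=> [p q] [/= cp dq].
  apply: cvg_pair => /=.
    apply: (@cvg_comp _ _ _ fst (fwd c)); first exact: cvg_fst.
    exact: (chart_fwd_cts hc cp).
  apply: (@cvg_comp _ _ _ snd (fwd d)); first exact: cvg_snd.
  exact: (chart_fwd_cts hd dq).
- move=> [p q]; rewrite iE => -[/= cp dq].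
  apply: cvg_pair => /=.
    apply: (@cvg_comp _ _ _ fst (bwd c)); first exact: cvg_fst.
    exact: (chart_bwd_cts hc cp).
  apply: (@cvg_comp _ _ _ snd (bwd d)); first exact: cvg_snd.
  exact: (chart_bwd_cts hd dq).
Qed.

(** Around each point [p], the expression of [g \o f] in the charts [c] and [e] factors through a
    chart [d] at [f p]; [Ck_local] glues these local factorizations. *)
Lemma smooth_map_comp E F n M N P (A : set (chart E M))
    (B : set (chart 'rV[R]_n N)) (C : set (chart F P)) (f : M -> N) (g : N -> P) :
  smooth_atlas A -> smooth_atlas B -> smooth_atlas C ->
  smooth_map A B f -> smooth_map B C g -> smooth_map A C (g \o f).
Proof.
move=> hA hB hC [cf sf] [cg sg]; split.
  by move=> x; apply: continuous_comp; [exact: cf|exact: cg].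
move=> c e Ac Ce k; apply: Ck_local => _ [p [cp ep] <-].
have [d Bd dp] := atlas_cover hB (f p).
have hc := atlas_chart hA Ac; have hd := atlas_chart hB Bd.
have oe := chart_open (atlas_chart hC Ce).
pose O := f @^-1` (dom d `&` g @^-1` dom e).
have oO : open O.
  apply: open_comp => [x _|]; first exact: cf.
  apply: openI; first exact: chart_open.
  by apply: open_comp => // x _; exact: cg.
exists (fwd c @` (dom c `&` O)); first by exists p.
have oV := chart_image_open hc oO.
have fV y : (fwd c @` (dom c `&` O)) y ->
    (fwd d @` (dom d `&` g @^-1` dom e)) ((fwd d \o f \o bwd c) y).
  move=> [q [cq [dq eq]] <-] /=; rewrite (chart_fwdK hc cq).
  by exists (f q).
have cfV : Ck k (fwd c @` (dom c `&` O)) (fwd d \o f \o bwd c).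
  have := sf c d Ac Bd k; apply: Ck_sub => _ [q [cq [dq _]] <-].
  by exists q.
apply: Ck_congr (Ck_comp oV fV cfV (sg d e Bd Ce k)) => //.
move=> _ [q [cq [dq eq]] <-] /=.
by rewrite (chart_fwdK hc cq) (chart_fwdK hd dq).
Qed.

Lemma smooth_map_vectP E F (f : E -> F) k :
  smooth_map (vect_atlas E) (vect_atlas F) f -> Ck k setT f.
Proof.
move=> [_ /(_ (Chart setT id id) (Chart setT id id) erefl erefl k)] /=.
by apply: Ck_sub => x _; exists x.
Qed.

End Manifolds.

(** * Smoothness of left and right translations *)

Section LieGroups.
Context (R : realType) (n : nat) (G : lieGroupType R n).
Let A : set (chart 'rV[R]_n G) := lie_atlas.
Let c1 : chart 'rV[R]_n G := lie_chart1.

(** In a product chart around [(g, h)], the translation is the multiplication with the coordinate of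
    [g] frozen. *)
Lemma smooth_mulgl (g : G) : smooth_map A A (fun h => g * h)%g.
Proof.
have [cm sm] := @lie_mul_smooth R n G.
split.
  move=> h; apply: (@continuous_comp _ _ _ (fun h => (g, h))
    (fun z : G * G => z.1 * z.2)%g).
    by apply: cvg_pair; [exact: cvg_cst|exact: cvg_id].
  exact: cm.
move=> c d Ac Ad k.
have [c0 Ac0 c0g] := atlas_cover lie_atlas_smooth g.
have hc := atlas_chart lie_atlas_smooth Ac.
have hc0 := atlas_chart lie_atlas_smooth Ac0.
have hd := atlas_chart lie_atlas_smooth Ad.
have hp := prod_is_chart hc0 hc.
have Ap : prod_atlas A A (prod_chart c0 c) by exists c0, c.
have oU := chart_image_open hp
  (open_comp (fun x _ => cm x) (chart_open hd)).
have := Ck_section2 (fwd c0 g) oU (sm _ _ Ap Ad k).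
have -> : (fun y => (fwd d \o (fun z : G * G => z.1 * z.2)%g \o
    bwd (prod_chart c0 c)) (fwd c0 g, y)) =
    fwd d \o (fun h => g * h)%g \o bwd c.
  by apply/funext => y /=; rewrite (chart_fwdK hc0 c0g).
apply: Ck_sub => _ [h [ch dh] <-] /=.
by exists (g, h).
Qed.

Lemma smooth_mulgr (g : G) : smooth_map A A (fun h => h * g)%g.
Proof.
have [cm sm] := @lie_mul_smooth R n G.
split.
  move=> h; apply: (@continuous_comp _ _ _ (fun h => (h, g))
    (fun z : G * G => z.1 * z.2)%g).
    by apply: cvg_pair; [exact: cvg_id|exact: cvg_cst].
  exact: cm.
move=> c d Ac Ad k.
have [c0 Ac0 c0g] := atlas_cover lie_atlas_smooth g.
have hc := atlas_chart lie_atlas_smooth Ac.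
have hc0 := atlas_chart lie_atlas_smooth Ac0.
have hd := atlas_chart lie_atlas_smooth Ad.
have hp := prod_is_chart hc hc0.
have Ap : prod_atlas A A (prod_chart c c0) by exists c, c0.
have oU := chart_image_open hp
  (open_comp (fun x _ => cm x) (chart_open hd)).
have := Ck_section1 (fwd c0 g) oU (sm _ _ Ap Ad k).
have -> : (fun y => (fwd d \o (fun z : G * G => z.1 * z.2)%g \o
    bwd (prod_chart c c0)) (y, fwd c0 g)) =
    fwd d \o (fun h => h * g)%g \o bwd c.
  by apply/funext => y /=; rewrite (chart_fwdK hc0 c0g).
apply: Ck_sub => _ [h [ch dh] <-] /=.
by exists (h, g).
Qed.

End LieGroups.

(** * The exponential map *)

Lemma derive_comp_curve (R : realType) (E F : normedModType R) (h : R -> E)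
    (f : E -> F) (t : R) : differentiable h t -> differentiable f (h t) ->
  'D_1 (f \o h) t = 'd f (h t) ('d h t 1).
Proof.
move=> dh df; rewrite deriveE; last exact: differentiable_comp.
by rewrite (diff_comp dh df).
Qed.

Section Exponential.
Context (R : realType) (n : nat) (G : lieGroupType R n)
  (exp : 'rV[R]_n -> G) (hexp : is_exp exp).
Let A : set (chart 'rV[R]_n G) := lie_atlas.
Let c1 : chart 'rV[R]_n G := lie_chart1.

Let c1_chart : is_chart c1.
Proof. exact: (atlas_chart lie_atlas_smooth lie_chart1_in). Qed.

Lemma exp_one_parameter v : one_parameter_subgroup (fun t => exp (t *: v)) v.
Proof. exact/hexp. Qed.

Lemma expD v s t : exp ((s + t) *: v) = (exp (s *: v) * exp (t *: v))%g.
Proof. by have [_ ->] := exp_one_parameter v. Qed.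

Lemma exp0 : exp 0 = 1%g.
Proof.
have := expD 0 0 0; rewrite !scaler0 => /(congr1 (fun g => (exp 0)^-1 * g)%g).
by rewrite mulgA mulVg mul1g.
Qed.

Lemma expN v : exp (- v) = (exp v)^-1%g.
Proof.
have := expD v (-1) 1; rewrite addNr scale0r exp0 scaleN1r scale1r.
move=> /(congr1 (fun g => g * (exp v)^-1)%g).
by rewrite mul1g -mulgA mulgV mulg1.
Qed.

Lemma smooth_map_lieS (f : G -> G) : smooth_map A A f -> f 1%g = 1%g ->
  differentiable (fwd c1 \o f \o bwd c1) (fwd c1 1%g).
Proof.
move=> [_ sf] f1.
have [df _] := sf c1 c1 lie_chart1_in lie_chart1_in 1%N.
apply: df; exists 1%g => //; split; first exact: lie_chart1_dom.
by rewrite /= f1; exact: lie_chart1_dom.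
Qed.

(** The chain rule in the chart at 1; inserting [bwd c1 \o fwd c1] is legitimate only for small
    times, when the curve stays in the chart domain. *)
Lemma dmap1_curve (f : G -> G) (gamma : R -> G) :
  smooth_map A A f -> f 1%g = 1%g ->
  smooth_map (vect_atlas R) A gamma -> gamma 0 = 1%g ->
  derive1 (fwd c1 \o (f \o gamma)) 0 = dmap1 f (derive1 (fwd c1 \o gamma) 0).
Proof.
move=> sf f1 sg g0.
have df := smooth_map_lieS sf f1.
case: sg => cg sg.
have dg : differentiable (fwd c1 \o gamma) (0 : R).
  have [dg _] := sg (Chart setT id id) c1 erefl lie_chart1_in 1%N.
  by apply: dg; exists 0 => //; split=> //=; rewrite g0; exact: lie_chart1_dom.
have df' : differentiable (fwd c1 \o f \o bwd c1) ((fwd c1 \o gamma) 0).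
  by rewrite /= g0.
rewrite derive1E derive1E' // /dmap1 (deriveE _ df).
have near_dom : \forall t \near (0 : R), dom c1 (gamma t).
  apply: cg; apply: open_nbhs_nbhs; split; first exact: chart_open.
  by rewrite /= g0; exact: lie_chart1_dom.
rewrite -(@near_eq_derive _ _ _ ((fwd c1 \o f \o bwd c1) \o (fwd c1 \o gamma))).
  rewrite (derive_comp_curve dg df').
  by have -> : (fwd c1 \o gamma) 0 = fwd c1 1%g by rewrite /comp g0.
near=> t => /=.
by rewrite (chart_fwdK c1_chart) //; near: t.
Unshelve. all: by end_near. Qed.

Lemma dmap1Z (f : G -> G) a v : smooth_map A A f -> f 1%g = 1%g ->
  dmap1 f (a *: v) = a *: dmap1 f v.
Proof.
move=> sf f1; have df := smooth_map_lieS sf f1.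
by rewrite /dmap1 !(deriveE _ df) linearZ.
Qed.

(** The image of a one-parameter subgroup under [f] is a one-parameter subgroup with initial
    velocity [dmap1 f v]; uniqueness in [is_exp] identifies it. *)
Lemma morphism_exp (f : G -> G) v t : smooth_map A A f ->
  (forall g h, f (g * h)%g = (f g * f h)%g) ->
  f (exp (t *: v)) = exp (t *: dmap1 f v).
Proof.
move=> sf fM.
have f1 : f 1%g = 1%g.
  have := fM 1%g 1%g; rewrite mulg1 => /(congr1 (fun g => (f 1)^-1 * g)%g).
  by rewrite mulgA mulVg mul1g.
have [sg gD dg] := exp_one_parameter v.
have /hexp : one_parameter_subgroup (f \o (fun t => exp (t *: v))) (dmap1 f v).
  split.
  - apply: smooth_map_comp sg sf; [exact: vect_smooth_atlas| |];
      exact: lie_atlas_smooth.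
  - by move=> s u /=; rewrite gD fM.
  - by rewrite (dmap1_curve sf f1 sg) ?dg // scale0r exp0.
by move=> /(congr1 (fun g => g t)).
Qed.

(** Serves to show that a vector lies in [cartan_k] when [Theta] fixes its ray pointwise. *)
Lemma exp_velocity_inj u v : (forall t : R, exp (t *: u) = exp (t *: v)) -> u = v.
Proof.
move=> uv; have [_ _ du] := exp_one_parameter u.
have [_ _ dv] := exp_one_parameter v.
have uvE : (fun t : R => exp (t *: u)) = (fun t => exp (t *: v)) by exact/funext.
by rewrite uvE in du; exact: etrans (esym du) dv.
Qed.

Lemma conj_exp g v t :
  (g * exp (t *: v) * g^-1)%g = exp (t *: Ad g v).
Proof.
apply: (morphism_exp (f := fun h => (g * h * g^-1)%g)).
  apply: (smooth_map_comp _ _ _ (smooth_mulgl g) (smooth_mulgr g^-1%g));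
    exact: lie_atlas_smooth.
by move=> h k; rewrite !mulgA -(mulgA (g * h)%g g^-1%g g) mulVg mulg1.
Qed.

End Exponential.

(** * Convex functions of one variable *)

Section Convex.
Context (R : realType) (f : R -> R).
Context (df : forall t, derivable f t 1)
  (ddf : forall t, derivable (derive1 f) t 1)
  (convf : forall t, 0 <= derive1n 2 f t).

Let cf : continuous f.
Proof. by move=> x; exact/differentiable_continuous/derivable1_diffP. Qed.

Let cdf : continuous (derive1 f).
Proof. by move=> x; exact/differentiable_continuous/derivable1_diffP. Qed.

Lemma derive1_ndecr s t : s <= t -> derive1 f s <= derive1 f t.
Proof.
move=> st.
apply: (@ger0_derive1_ndecr _ (derive1 f) s t _ _ _ s t (lexx s) st (lexx t)).
- by move=> x _; exact: ddf.
- by move=> x _; have := convf x; rewrite derive1nS derive1n1.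
- exact: continuous_subspaceT.
Qed.

Lemma mean_value s t : s < t ->
  exists2 c, s < c < t & f t - f s = derive1 f c * (t - s).
Proof.
move=> st; have [||c] := @MVT R f (derive1 f) s t st.
- by move=> x _; rewrite derive1E; exact: derivableP.
- exact: continuous_subspaceT.
by rewrite in_itv /= => cst fE; exists c.
Qed.

Lemma tangent_le s t : f s + derive1 f s * (t - s) <= f t.
Proof.
have [st|ts|->] := ltgtP s t; last by rewrite subrr mulr0 addr0.
- have [c /andP[sc ct] fE] := mean_value st.
  rewrite addrC -lerBrDr fE ler_wpM2r ?subr_ge0 ?(ltW st) //.
  exact: derive1_ndecr (ltW sc).
- have [c /andP[tc cs] fE] := mean_value ts.
  rewrite -(opprB s t) mulrN lerBlDr -lerBlDl fE.
  rewrite ler_wpM2r ?subr_ge0 ?(ltW ts) //.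
  exact: derive1_ndecr (ltW cs).
Qed.

(** The mean value theorem gives a point [c] in (0, 1) with nonpositive slope. The derivative is
    nondecreasing and vanishes at 0, so it vanishes on all of [0, c]. *)
Lemma flat_derive2_eq0 : derive1 f 0 = 0 -> f 1 <= f 0 -> derive1n 2 f 0 = 0.
Proof.
move=> f'0 f10.
have [c /andP[c0 c1] fE] := mean_value ltr01.
have f'c : derive1 f c = 0.
  apply/eqP; rewrite eq_le -{2}f'0 derive1_ndecr ?(ltW c0) // andbT.
  by move: f10; rewrite -subr_le0 fE subr0 mulr1.
have f'E t : 0 < t < c -> derive1 f t = 0.
  move=> /andP[t0 tc]; apply/eqP; rewrite eq_le.
  by rewrite -{1}f'c -f'0 !derive1_ndecr ?(ltW t0) ?(ltW tc).
rewrite derive1nS derive1n1 derive1E.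
(* The second derivative exists, so it is a right-hand limit, taken where the difference quotients
   are 0. *)
rewrite /derive cvg_at_rightE; last exact: ddf.
apply: cvg_lim => //; apply: cvg_near_cst.
near=> t; rewrite /= f'0 subr0 [_%:A]mulr1 ?addr0 f'E ?scaler0 //.
by apply/andP; split; near: t; [exact: nbhs_right_gt|exact: nbhs_right_lt].
Unshelve. all: by end_near. Qed.

(** Compare the tangent at [s] with [f] at 0 and at [t], with weights [t - s] and [s]: the slope
    terms cancel. *)
Lemma convex_growth s t : f 0 = 0 -> 0 < s -> s <= t -> t * f s <= s * f t.
Proof.
move=> f0 s0 st.
have t_s : 0 <= t - s by rewrite subr_ge0.
have := ler_wpM2l t_s (tangent_le s 0); rewrite f0.
have := ler_wpM2l (ltW s0) (tangent_le s t).
lra.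
Qed.

Lemma derive1_gt0_unbounded s B : 0 < derive1 f s ->
  exists2 T, 0 <= T & forall t, T <= t -> B < f t.
Proof.
(* [u] is the time in which the tangent at [s] rises by [|B - f s| + 1]. *)
move=> f's; pose u := (`|B - f s| + 1) / derive1 f s.
exists (`|s| + u); first by rewrite addr_ge0 // divr_ge0 ?addr_ge0 // ltW.
move=> t Tt; apply: lt_le_trans (tangent_le s _).
rewrite -ltrBlDl; apply: le_lt_trans (ler_norm _) _.
apply: (@lt_le_trans _ _ (derive1 f s * u)).
  by rewrite /u mulrC divfK ?gt_eqF // ltrDl.
rewrite ler_wpM2l ?(ltW f's) // lerBrDl (le_trans _ Tt) // lerD2r.
exact: ler_norm.
Qed.

End Convex.

(** The limit at infinity of a nondecreasing function is the supremum of its values. *)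
Lemma Lambda_gt0 (R : realType) (f : R -> R) :
  (forall s t, s <= t -> f s <= f t) ->
  (0 < lim ((fun t : R => (f t)%:E) @ +oo%R))%E <-> exists t, 0 < f t.
Proof.
move=> ndf.
have -> : lim ((fun t : R => (f t)%:E) @ +oo%R) =
    ereal_sup (range (fun t => (f t)%:E)).
  by apply: cvg_lim => //; apply: nondecreasing_cvge => s t st; rewrite lee_fin ndf.
split=> [/ereal_sup_gt[_ [t _ <-]]|[t t0]]; first by rewrite lte_fin => ?; exists t.
by apply: (@lt_le_trans _ _ (f t)%:E) => //; apply: ereal_sup_ubound; exists t.
Qed.

(** * Consequences of the polar decomposition *)

Section Polar.
Context (R : realType) (n : nat) (G : lieGroupType R n)
  (exp : 'rV[R]_n -> G) (Theta : G -> G)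
  (hG : real_reductive exp Theta).
Let K := fixed_group Theta.
Let p := cartan_p Theta.

Lemma cartan_involution1 : Theta 1%g = 1%g.
Proof.
have := cartan_morph (reductive_cartan hG) 1%g 1%g.
rewrite mulg1 => /(congr1 (fun g => (Theta 1)^-1 * g)%g).
by rewrite mulgA mulVg mul1g.
Qed.

Lemma cartan_pZ t v : p v -> p (t *: v).
Proof.
rewrite /p /cartan_p /= => pv.
rewrite dmap1Z ?pv ?scalerN //; first exact: cartan_smooth (reductive_cartan hG).
exact: cartan_involution1.
Qed.

Lemma cartan_p0 : p 0.
Proof.
have [_ [_ [pi [_ _ /(_ 1%g) [_ pp _] _]]]] := reductive_polar hG.
by rewrite -(scale0r (pi 1%g)); exact: cartan_pZ.
Qed.

(** [is_exp] speaks of one ray at a time; continuity in [v] is read off the polar map at [k = 1]. *)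
Lemma exp_continuous : continuous exp.
Proof.
have [[cm _] _] := reductive_polar hG.
pose polar (z : G * 'rV[R]_n) := (z.1 * exp z.2)%g.
have -> : exp = polar \o (fun v => (1%g, v)).
  by apply/funext => v; rewrite /polar /= mul1g.
move=> v; apply: (@continuous_comp _ _ _ (fun v => (1%g, v)) polar); last exact: cm.
exact: (@cvg_pair _ _ _ (nbhs v) (nbhs (1%g : G)) (nbhs v) _ _ _
  (fun=> 1%g) id (cvg_cst _) cvg_id).
Qed.

Lemma polar_decomposition : exists kappa : G -> G, exists pi : G -> 'rV[R]_n,
  [/\ continuous pi, forall g, K (kappa g), forall g, p (pi g),
      forall g, (kappa g * exp (pi g))%g = g & forall v, p v -> pi (exp v) = v].
Proof.
have [_ [kappa [pi [_ [cpi _] kp pk]]]] := reductive_polar hG.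
exists kappa, pi; split=> // [g|g|g|v pv]; try by have [] := kp g.
by have [_] := pk 1%g v cartan_involution1 pv; rewrite mul1g.
Qed.

(** [p] is the fixed point set of the continuous map [pi \o exp]. *)
Lemma cartan_p_closed : closed p.
Proof.
have [kappa [pi [cpi _ pp _ pE]]] := polar_decomposition.
have -> : p = (fun v => pi (exp v) - v) @^-1` [set 0].
  apply/seteqP; split=> v /=; first by move=> /pE ->; rewrite subrr.
  by move=> /subr0_eq <-; exact: pp.
apply: preimage_closed => [v _|]; last first.
  by apply: accessible_closed_set1; apply: hausdorff_accessible; exact: norm_hausdorff.
apply: (@continuousB _ _ _ (pi \o exp) id); last exact: cvg_id.
by apply: continuous_comp; [exact: exp_continuous|exact: cpi].
Qed.

Lemma cartan_p_ball_compact r : compact (p `&` [set v | `|v| <= r]).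
Proof.
apply: bounded_closed_compact.
  exists r; split; first exact: num_real.
  by move=> s rs v [_ /= vr]; exact: le_trans (ltW rs).
apply: closedI; first exact: cartan_p_closed.
rewrite (_ : mkset _ = (fun v : 'rV[R]_n => `|v|) @^-1` [set s | s <= r]) //.
by apply: preimage_closed (@closed_le _ _) => v _; exact: norm_continuous.
Qed.

Lemma cartan_p_sphere_compact : compact (p `&` [set v | `|v| = 1]).
Proof.
apply: (subclosed_compact _ (@cartan_p_ball_compact 1)); last first.
  by move=> v [pv /= v1]; split=> //=; rewrite v1.
apply: closedI; first exact: cartan_p_closed.
rewrite (_ : mkset _ = (fun v : 'rV[R]_n => `|v|) @^-1` [set s | s = 1]) //.
by apply: preimage_closed (@closed_eq _ _) => v _; exact: norm_continuous.
Qed.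

(* The continuous [pi] is bounded on the compact set containing the curve, while
   [pi (exp (t *: v)) = t *: v]. *)
Lemma exp_ray_bounded (a b : G) v r : p v ->
  (forall t, 0 <= t -> exists k w,
    [/\ K k, p w, `|w| <= r & exp (t *: v) = (a * (k * exp w) * b)%g]) ->
  v = 0.
Proof.
move=> pv H.
have [kappa [pi [cpi _ pp _ pE]]] := polar_decomposition.
have [[cm _] _] := reductive_polar hG.
have [_ compK _] := reductive_maximal_compact hG.
pose m (z : G * 'rV[R]_n) := pi (a * (z.1 * exp z.2) * b)%g.
have cK : compact (m @` (K `*` (p `&` [set w | `|w| <= r]))).
  apply: continuous_compact; last first.
    exact: compact_setX compK (@cartan_p_ball_compact r).
  apply: continuous_subspaceT => z.
  apply: (@continuous_comp _ _ _
    (fun z : G * 'rV[R]_n => a * (z.1 * exp z.2) * b)%g pi).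
    apply: (@continuous_comp _ _ _
      (fun z : G * 'rV[R]_n => a * (z.1 * exp z.2))%g (fun g => g * b)%g).
      apply: (@continuous_comp _ _ _
        (fun z : G * 'rV[R]_n => z.1 * exp z.2)%g (fun g => a * g)%g).
        exact: cm.
      by have [+ _] := smooth_mulgl a; apply.
    by have [+ _] := smooth_mulgr b; apply.
  exact: cpi.
have [M [_ HM]] := compact_bounded cK.
apply/eqP/negP => /negP v0.
have vn0 : 0 < `|v| by rewrite normr_gt0.
(* This time makes the norm of [t *: v] equal to [|M| + 2], beyond the bound [|M| + 1] on the image
   of [m]. *)
pose t := (`|M| + 2) / `|v|.
have t0 : 0 <= t by rewrite divr_ge0 // addr_ge0.
have [k [w [Kk pw wr tE]]] := H t t0.
have : `|t *: v| <= `|M| + 1.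
  apply: (HM (`|M| + 1)); first by rewrite (le_lt_trans (ler_norm M)) // ltrDl.
  by exists (k, w) => //; rewrite /m /= -tE pE //; exact: cartan_pZ.
rewrite normrZ (ger0_norm t0) divfK ?gt_eqF // lerD2l.
by rewrite leNgt ltr1n.
Qed.

End Polar.

(** * Kempf-Ness functions *)

Section KempfNessFunction.
Context (R : realType) (n : nat) (G : lieGroupType R n)
  (exp : 'rV[R]_n -> G) (Theta : G -> G) (M : topologicalType)
  (act : G -> M -> M) (Psi : M -> G -> R)
  (hexp : is_exp exp) (hG : real_reductive exp Theta)
  (hact : continuous_action act) (hPsi : kempf_ness exp Theta act Psi).
Let K := fixed_group Theta.
Let p := cartan_p Theta.

Lemma kempf_ness1 x : Psi x 1%g = 0.
Proof.
have := kn_cocycle hPsi x 1%g 1%g.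
by rewrite (act_id hact) mulg1 -[RHS]addr0 => /addrI.
Qed.

Lemma ray0 x v : ray exp Psi x v 0 = 0.
Proof. by rewrite /ray scale0r (exp0 hexp) kempf_ness1. Qed.

Lemma ray1 x v : ray exp Psi x v 1 = Psi x (exp v).
Proof. by rewrite /ray scale1r. Qed.

Lemma ray_Ck x v : Ck 2 setT (ray exp Psi x v).
Proof.
have [sv _ _] := exp_one_parameter hexp v.
apply: smooth_map_vectP; apply: smooth_map_comp sv (kn_smooth hPsi x).
- exact: vect_smooth_atlas.
- exact: lie_atlas_smooth.
- exact: vect_smooth_atlas.
Qed.

Lemma ray_derivable x v t : derivable (ray exp Psi x v) t 1.
Proof. by have [d _] := ray_Ck x v; exact/diff_derivable/d. Qed.

Lemma ray_derivable2 x v t : derivable (derive1 (ray exp Psi x v)) t 1.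
Proof.
have [_ /(_ 1) [d _]] := ray_Ck x v.
have -> : derive1 (ray exp Psi x v) = (fun t => 'D_1 (ray exp Psi x v) t).
  by apply/funext => s; rewrite derive1E.
exact/diff_derivable/d.
Qed.

Lemma LambdaP x v : p v ->
  (0 < Lambda exp Psi x v)%E <-> exists t, 0 < derive1 (ray exp Psi x v) t.
Proof.
move=> pv; apply: (@Lambda_gt0 _ (derive1 (ray exp Psi x v))) => s t st.
exact: (derive1_ndecr (@ray_derivable2 x v) (kn_convex hPsi x pv) st).
Qed.

Lemma ray_growth x v s t : p v -> 0 < s -> s <= t ->
  t * Psi x (exp (s *: v)) <= s * Psi x (exp (t *: v)).
Proof.
move=> pv; apply: (@convex_growth _ (ray exp Psi x v)).
- exact: ray_derivable.
- exact: ray_derivable2.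
- exact: (kn_convex hPsi x pv).
- exact: ray0.
Qed.

Lemma ray_tangent x v s t : p v ->
  ray exp Psi x v s + derive1 (ray exp Psi x v) s * (t - s) <= ray exp Psi x v t.
Proof.
move=> pv; apply: tangent_le; [exact: ray_derivable|exact: ray_derivable2|].
exact: (kn_convex hPsi x pv).
Qed.

(** Turns zero slope at 0 and no growth up to time 1 into the infinitesimal condition of
    [kn_flat]. *)
Lemma ray_flat x v : p v -> derive1 (ray exp Psi x v) 0 = 0 ->
  Psi x (exp v) <= 0 -> forall t : R, stabilizer act x (exp (t *: v)).
Proof.
move=> pv d0 le0; apply/(kn_flat hPsi x pv); apply: flat_derive2_eq0 d0 _.
- exact: ray_derivable.
- exact: ray_derivable2.
- exact: (kn_convex hPsi x pv).
- by rewrite ray0 ray1.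
Qed.

Lemma Psi_exp_continuous x : continuous (fun v => Psi x (exp v)).
Proof.
move=> v; apply: continuous_comp; first exact: (exp_continuous hG).
by have [+ _] := kn_smooth hPsi x; apply.
Qed.

(* If [exp (R v)] fixes no point for [v != 0], strict convexity at the critical
   point [y] makes [Psi y (exp v)] grow at least linearly. *)
Lemma critical_growth y : gradient_map (Theta := Theta) exp Psi y = (fun=> 0) ->
  (forall v, p v -> (forall t : R, stabilizer act y (exp (t *: v))) -> v = 0) ->
  exists2 c, 0 < c & forall v, p v -> 1 <= `|v| -> c * `|v| <= Psi y (exp v).
Proof.
move=> Fy noray.
have pos v : p v -> v != 0 -> 0 < Psi y (exp v).
  move=> pv v0; rewrite ltNge; apply: contra v0 => le0; apply/eqP/noray => //.
  apply: ray_flat le0 => //.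
  by have := congr1 (fun F => F (SigSub (mem_set pv))) Fy.
have normalized v : v != 0 -> p v -> p (`|v|^-1 *: v) /\ `| (`|v|^-1 *: v) | = 1.
  move=> v0 pv; split; first exact: (cartan_pZ hG).
  by rewrite normrZ normfV normr_id mulVf // normr_eq0.
have nz (v : 'rV[R]_n) : 1 <= `|v| -> v != 0.
  by move=> v1; have := lt_le_trans ltr01 v1; rewrite normr_gt0.
(* If the unit sphere of [p] is empty, no [v] in [p] has norm at least 1 and any constant works;
   otherwise [c] is the minimum of [Psi y] over the image of the sphere. *)
have [S0|/set0P/negP/negPn/eqP S0] :=
  pselect ((p `&` [set v : 'rV[R]_n | `|v| = 1]) !=set0); last first.
  exists 1 => // v pv /nz v0; have [? ?] := normalized v v0 pv.
  by have : @set0 'rV[R]_n (`|v|^-1 *: v) by rewrite -S0.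
have [u] := EVT_min_rV S0 (cartan_p_sphere_compact hG)
  (continuous_subspaceT (@Psi_exp_continuous y)).
rewrite inE => -[pu /= u1] umin.
exists (Psi y (exp u)); first by apply: pos => //; apply: nz; rewrite u1.
move=> v pv v1; have v0 := nz v v1; have [pw w1] := normalized v v0 pv.
have := ray_growth y pw ltr01 v1.
rewrite scale1r mul1r scalerA divff ?normr_eq0 // scale1r; apply: le_trans.
by rewrite mulrC ler_wpM2l //; apply: umin; rewrite inE.
Qed.

(** Compactness of the unit sphere gives one radius beyond which [Psi x] is positive on [exp p]. As
    [Psi x 1 = 0], the minimum over the ball of that radius is global on [exp p], hence on [G] by
    left [K]-invariance. *)
Lemma Psi_minimum x :
  (forall v, p v -> v != 0 -> (0 < Lambda exp Psi x v)%E) ->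
  exists T : R, (forall v, p v -> T <= `|v| -> 0 < Psi x (exp v)) /\
    exists2 v0, p v0 & forall g, Psi x (exp v0) <= Psi x g.
Proof.
move=> Lpos.
have larger v s t : p v -> 0 < s -> s <= t -> 0 < Psi x (exp (s *: v)) ->
    0 < Psi x (exp (t *: v)).
  move=> pv s0 st h; rewrite -(pmulr_rgt0 _ s0).
  apply: lt_le_trans (ray_growth x pv s0 st).
  by rewrite mulr_gt0 // (lt_le_trans s0).
(* Directions along which [Psi x] is positive at time [i + 1]; the shift keeps this time positive,
   as [larger] requires. *)
pose V (i : nat) := [set v : 'rV[R]_n | 0 < Psi x (exp (i.+1%:R *: v))].
have oV i : setT i -> open (V i).
  move=> _.
  have -> : V i = (fun v => Psi x (exp (i.+1%:R *: v))) @^-1` [set r | 0 < r].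
    by [].
  apply: open_comp; last exact: open_gt.
  move=> v _; apply: (@continuous_comp _ _ _ (fun v : 'rV[R]_n => i.+1%:R *: v)
    (fun v => Psi x (exp v))); last exact: Psi_exp_continuous.
  exact: scaler_continuous.
have cover_sphere : p `&` [set v | `|v| = 1] `<=` cover setT V.
  move=> v [pv /= v1].
  have v0 : v != 0 by have := @ltr01 R; rewrite -v1 normr_gt0.
  have /(LambdaP x pv)[t t0] := Lpos v pv v0.
  have [T T0 HT] := derive1_gt0_unbounded (@ray_derivable x v)
    (@ray_derivable2 x v) (kn_convex hPsi x pv) 0 t0.
  exists (Num.truncn T) => //=; apply: HT; apply: ltW.
  by rewrite truncnS_gt.
have := cartan_p_sphere_compact hG.
rewrite compact_cover => /(_ _ _ _ oV cover_sphere) [D _ coverD].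
(* [m] dominates all times of the finite subcover; the 1 in the radius below makes [v] nonzero. *)
pose m := \max_(i <- finmap.enum_fset D) i.+1.
have far v : p v -> Num.max 1 m%:R <= `|v| -> 0 < Psi x (exp v).
  move=> pv; rewrite ge_max => /andP[v1 vm].
  have v0 : v != 0 by have := lt_le_trans ltr01 v1; rewrite normr_gt0.
  pose w := `|v|^-1 *: v.
  have pw : p w by exact: (cartan_pZ hG).
  have [|i /= Di Vi] := coverD w.
    by split=> //=; rewrite normrZ normfV normr_id mulVf // normr_eq0.
  have -> : v = `|v| *: w by rewrite scalerA divff ?scale1r // normr_eq0.
  apply: larger Vi => //; apply: le_trans vm; rewrite ler_nat.
  by rewrite /m (big_rem i) //= leq_maxl.
exists (Num.max 1 m%:R); split=> //.
have B0 : p `&` [set v | `|v| <= Num.max 1 m%:R] !=set0.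
  by exists 0; split; [exact: (cartan_p0 hG)|rewrite /= normr0 le_max ler01].
have [v0] := EVT_min_rV B0 (@cartan_p_ball_compact _ _ _ _ _ hG _)
  (continuous_subspaceT (@Psi_exp_continuous x)).
rewrite inE => -[pv0 _] v0min; exists v0 => // g.
have [kappa [pi [_ Kk pp decomp _]]] := polar_decomposition hG.
rewrite -[g]decomp (kn_invariant hPsi) //.
have [le|lt] := leP `|pi g| (Num.max 1 m%:R).
  by apply: v0min; rewrite inE; split; first exact: pp.
apply: (@le_trans _ _ 0); last exact: (ltW (far _ (pp g) (ltW lt))).
rewrite -(kempf_ness1 x) -(exp0 hexp); apply: v0min; rewrite inE; split=> /=.
  exact: (cartan_p0 hG).
by rewrite normr0 le_max ler01.
Qed.

End KempfNessFunction.

(** * Stability and positivity of [Lambda] *)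

Section Stability.
Context (R : realType) (n : nat) (G : lieGroupType R n)
  (exp : 'rV[R]_n -> G) (Theta : G -> G) (M : topologicalType)
  (act : G -> M -> M) (Psi : M -> G -> R)
  (hexp : is_exp exp) (hG : real_reductive exp Theta)
  (hact : continuous_action act) (hPsi : kempf_ness exp Theta act Psi).
Let K := fixed_group Theta.
Let p := cartan_p Theta.

Lemma actK g x : act g^-1%g (act g x) = x.
Proof. by rewrite -(act_comp hact) mulVg (act_id hact). Qed.

(* [Ad (h g^-1)] maps [v] into [k], so a conjugate of the ray [exp (R v)] lies
   in the compact group [K], and properness of [exp] on [p] forces [v = 0]. *)
Lemma conjugate_stabilizer_ray (g h : G) x v :
  Ad h @` lie_of exp (stabilizer act x) `<=` cartan_k Theta ->
  p v -> (forall t : R, stabilizer act (act g x) (exp (t *: v))) -> v = 0.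
Proof.
move=> hk pv stab_v.
pose u := Ad g^-1%g v.
have uE t : exp (t *: u) = (g^-1 * exp (t *: v) * g)%g.
  by rewrite -(conj_exp hexp) invgK.
have stab_u : lie_of exp (stabilizer act x) u.
  by move=> t; rewrite /stabilizer /= uE !(act_comp hact) stab_v actK.
pose w := Ad h u.
have kw : dmap1 Theta w = w by apply: hk; exists u.
have wE t : exp (t *: w) = (h * exp (t *: u) * h^-1)%g.
  by rewrite (conj_exp hexp).
have Kw t : K (exp (t *: w)).
  have cT := reductive_cartan hG.
  rewrite /K /fixed_group /=.
  by rewrite (morphism_exp hexp _ _ (cartan_smooth cT) (cartan_morph cT)) kw.
(* Undoing both conjugations leaves a middle factor in [K], whose [p]-component is 0; hence the
   radius 0. *)
apply: (exp_ray_bounded hG (a := (g * h^-1)%g) (b := (h * g^-1)%g) (r := 0) pv).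
move=> t _; exists (exp (t *: w)), 0; split;
  [exact: Kw|exact: (cartan_p0 hG)|by rewrite normr0|].
rewrite (exp0 hexp) mulg1 wE uE.
by rewrite !mulgA !(mulgVK, mulgK) mulgV mul1g.
Qed.

(** By contradiction: if no slope along the ray of [xi] is positive, then [Psi x] is nonpositive on
    the ray for [t >= 0], the growth of [Psi y] bounds the [p]-components of [exp (t *: xi) * g^-1],
    and [exp_ray_bounded] forces [xi = 0]. *)
Lemma stable_Lambda_gt0 x xi : stable exp Theta act Psi x ->
  p xi -> xi != 0 -> (0 < Lambda exp Psi x xi)%E.
Proof.
move=> [[_ [[g _ <-] /= Fy]] [h hk]] pxi xi0; apply/(LambdaP hexp hPsi x pxi).
set y := act g x in Fy.
have [c c0 growth] := critical_growth hexp hG hact hPsi Fy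
  (fun v => @conjugate_stabilizer_ray g h x v hk).
apply: contrapT => /forallNP der; case/eqP: xi0.
have le0 t : 0 <= t -> Psi x (exp (t *: xi)) <= 0.
  move=> t0.
  have := ray_tangent hexp hPsi x t 0 pxi.
  rewrite (ray0 hexp hact hPsi) sub0r mulrN subr_le0 => /le_trans; apply.
  by rewrite mulr_le0_ge0 // leNgt; apply/negP/der.
pose B := Psi y g^-1%g.
have [kappa [pi [_ Kk pp decomp _]]] := polar_decomposition hG.
apply: (exp_ray_bounded hG (a := 1%g) (b := g) (r := Num.max 1 (B / c)) pxi).
move=> t t0; pose z := (exp (t *: xi) * g^-1)%g.
exists (kappa z), (pi z); split; [exact: Kk|exact: pp| |]; last first.
  by rewrite decomp mul1g /z mulgVK.
rewrite le_max; have [//|z1] := leP `|pi z| 1; rewrite /= ler_pdivlMr // mulrC.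
(* By invariance and the cocycle identity, [Psi y (exp (pi z)) = Psi y z = B + Psi x (exp (t *:
   xi))], which is at most [B]. *)
apply: le_trans (growth _ (pp z) (ltW z1)) _.
rewrite -(kn_invariant hPsi _ _ (Kk z)) decomp /z -(kn_cocycle hPsi) actK.
by rewrite gerDl le0.
Qed.

Lemma Lambda_gt0_stable x :
  (forall xi, p xi -> xi != 0 -> (0 < Lambda exp Psi x xi)%E) ->
  stable exp Theta act Psi x.
Proof.
move=> Lpos.
have [T [far [v0 pv0 v0min]]] := Psi_minimum hexp hG hact hPsi Lpos.
have [kappa [pi [_ Kk pp decomp _]]] := polar_decomposition hG.
pose y := act (exp v0) x.
have PsiyE g : Psi y g = Psi x (g * exp v0)%g - Psi x (exp v0).
  by rewrite -(kn_cocycle hPsi) addrC addKr.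
have Psiy_ge0 g : 0 <= Psi y g by rewrite PsiyE subr_ge0.
have Psi1 z := kempf_ness1 hact hPsi z.
have Fy v : derive1 (ray exp Psi y v) 0 = 0.
  rewrite derive1E.
  (* The ray function is nonnegative and vanishes at 0, an interior minimum on (-1, 1). *)
  have /@derive_val : is_derive (0 : R) 1 (ray exp Psi y v) 0 => //.
  apply: (@derive1_at_min _ _ (-1) 1) => //.
  - by move=> t _; exact: (ray_derivable hexp hPsi).
  - by rewrite in_itv /= ltrN10 ltr01.
  - by move=> t _; rewrite (ray0 hexp hact hPsi); exact: Psiy_ge0.
(* [Psi y] is a nonnegative homomorphism on the stabilizer of [y]. *)
have Psiy_stab g : stabilizer act y g -> Psi y g = 0.
  move=> gy; have := kn_cocycle hPsi y g g^-1%g.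
  rewrite gy mulVg Psi1 => /eqP; rewrite paddr_eq0 // => /andP[/eqP] //.
have stabK g : stabilizer act y g -> K g.
  move=> gy; rewrite -[g]decomp; suff -> : pi g = 0.
    by rewrite (exp0 hexp) mulg1; exact: Kk.
  have ray_stab : forall t : R, stabilizer act y (exp (t *: pi g)).
    apply: (ray_flat hexp hact hPsi (pp g) (Fy _)).
    by rewrite -(kn_invariant hPsi _ _ (Kk g)) decomp Psiy_stab.
  apply: (exp_ray_bounded hG (a := 1%g) (b := exp (- v0)) (r := T) (pp g)).
  (* Since [exp (t *: pi g)] fixes [y], [Psi x z] equals the minimum [Psi x (exp v0)], which is at
     most [Psi x 1 = 0]; positivity beyond [T] then bounds [pi z]. *)
  move=> t _; pose z := (exp (t *: pi g) * exp v0)%g.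
  exists (kappa z), (pi z); split; [exact: Kk|exact: pp| |]; last first.
    by rewrite decomp mul1g /z (expN hexp) mulgK.
  rewrite leNgt; apply/negP => /ltW Tz; have := far _ (pp z) Tz.
  rewrite -(kn_invariant hPsi _ _ (Kk z)) decomp.
  have /eqP := Psiy_stab _ (ray_stab t); rewrite PsiyE subr_eq0 => /eqP ->.
  by rewrite ltNge -(Psi1 x) v0min.
split.
  exists y; split; first by exists (exp v0).
  by apply/funext => v; exact: Fy.
(* [exp v0] conjugates the stabilizer of [x] into that of [y], which lies in [K], so [Theta] fixes
   the conjugated ray pointwise. *)
exists (exp v0) => _ [u stab_u <-]; apply: (exp_velocity_inj hexp) => t.
have cT := reductive_cartan hG.
rewrite -(morphism_exp hexp _ _ (cartan_smooth cT) (cartan_morph cT)).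
apply: stabK; rewrite -(conj_exp hexp) /stabilizer /=.
by rewrite !(act_comp hact) actK stab_u.
Qed.

End Stability.

Theorem theorem23 (R : realType) (n : nat) (G : lieGroupType R n)
    (exp : 'rV[R]_n -> G) (Theta : G -> G) (M : topologicalType)
    (act : G -> M -> M) (Psi : M -> G -> R)
    (hexp : is_exp exp)
    (hG : real_reductive exp Theta)
    (hGnc : ~ compact [set: G])
    (hM : hausdorff_space M)
    (hact : continuous_action act)
    (hPsi : kempf_ness exp Theta act Psi)
    (x : M) :
  stable exp Theta act Psi x <->
  forall xi : 'rV[R]_n, cartan_p Theta xi -> xi != 0 ->
    (0 < Lambda exp Psi x xi)%E.
Proof.
split=> [st xi|]; first exact: (stable_Lambda_gt0 hexp hG hact hPsi st).
exact: (Lambda_gt0_stable hexp hG hact hPsi).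
Qed.
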